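(* Let $\psi:M^m\to\bar M^{n+1}=I\times_hP$ be a complete mean curvature flow soliton with respect to $X=h(t)\partial_t$, with $M$ connected, and let $o\in M$ be fixed. Assume that for some $\chi\in C^1(\mathbb R)$ with $\chi\ge0$ on $\hat\eta(I)$, the function $\hat\eta(t)=\int_{t_0}^th(s)\,ds$ satisfies $\hat\eta'=\chi(\hat\eta)^{1/2}$ on $I$. Then there exists a constant $C\ge0$ such that $$|\nabla\eta(x)|\le\int_0^{r(x)}\big|h'(\pi\circ\psi\circ\gamma(\tau))\big|\,d\tau+C,$$ where $r(x)=\operatorname{dist}_M(o,x)$ and $\gamma:[0,r(x)]\to M$ is any minimizing unit speed geodesic connecting $o$ to $x\in M$. In particular, if $h'$ is bounded, then $$|\nabla\eta(x)|\le B\,r(x)+C$$ for some constants $B,C\ge0$.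
   Context: $I\subset\mathbb R$ is an open interval, $t_0\in I$ is fixed, $h:I\to(0,\infty)$ is smooth, $(P^n,g_0)$ is a Riemannian manifold, and $\bar M^{n+1}=I\times_hP$ is $I\times P$ with metric $dt^2+h(t)^2g_0$; $\pi(t,p)=t$. An isometric immersion $\psi:M^m\to\bar M^{n+1}$ is a mean curvature flow soliton with respect to $X$ if $c\,X^\perp=\mathbf H$ along $\psi$ for some constant $c\in\mathbb R$, where $\perp$ is projection on the normal bundle and $\mathbf H$ is the non-normalized mean curvature vector (the trace of the second fundamental form). It is complete if $M$ with the induced metric is complete. $\eta(x)=\hat\eta(\pi(\psi(x)))$ for $x\in M$. *)

(* Defs.v *)
From mathcomp Require Export all_boot all_order all_algebra.
From mathcomp Require Export all_classical all_reals all_analysis.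
Export Order.TTheory GRing.Theory Num.Theory.
Export numFieldNormedType.Exports.

Set Implicit Arguments.
Unset Strict Implicit.
Unset Printing Implicit Defensive.

Local Open Scope classical_set_scope.
Local Open Scope ring_scope.

(* Calculus on open sets. For finite-dimensional V, the map f is C^(k+1) on   *)
(* the open set U iff it is differentiable on U and all its directional       *)
(* derivatives 'D_v f are C^k on U.                                           *)
Section Smoothness.
Context {R : realType} {V W : normedModType R}.

Fixpoint Ck_on (k : nat) (U : set V) (f : V -> W) : Prop :=
  match k with
  | 0 => forall x, U x -> {for x, continuous f}
  | k'.+1 => (forall x, U x -> differentiable f x) /\
             (forall v, Ck_on k' U ('D_v f))
  end.

Definition smooth_on (U : set V) (f : V -> W) : Prop :=
  forall k, Ck_on k U f.

End Smoothness.

(* An atlas together with the coordinate expressions of a metric tensor; the  *)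
(* axioms are in [is_riemannian]. Vectors in coordinates are row vectors, so  *)
(* a linear map acts by right multiplication by its [jacobian] and the inner  *)
(* product of v and w is v *m g *m w^T.                                       *)
(*   A tangent vector at p is represented by its components in the chart      *)
(* [chart_at p]; hence the type of T_pM is 'rV[R]_m.                          *)
Record riemData (R : realType) (m : nat) := RiemData {
  points :> topologicalType ;
  chart : Type ;
  chart_at : points -> chart ;
  chart_dom : chart -> set points ;
  coord : chart -> points -> 'rV[R]_m ;
  param : chart -> 'rV[R]_m -> points ;  (* inverse of coord *)
  gmat : chart -> 'rV[R]_m -> 'M[R]_m }. (* (g_ij) in terms of coordinates *)

Arguments chart_at {R m r}.
Arguments chart_dom {R m r}.
Arguments coord {R m r}.
Arguments param {R m r}.
Arguments gmat {R m r}.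

Section Riemannian.
Context {R : realType}.
Notation mu := (@lebesgue_measure R).

Definition chart_img m (M : riemData R m) (i : chart M) : set 'rV[R]_m :=
  coord i @` chart_dom i.

Record is_riemannian m (M : riemData R m) : Prop := IsRiemannian {
  rm_hausdorff : hausdorff_space M ;
  rm_second_countable : @second_countable M ;
  rm_chart_at : forall p : M, chart_dom (chart_at p) p ;
  rm_dom_open : forall i : chart M, open (chart_dom i) ;
  rm_img_open : forall i : chart M, open (chart_img i) ;
  rm_coordK : forall (i : chart M) p, chart_dom i p -> param i (coord i p) = p ;
  rm_coord_cont : forall (i : chart M) p, chart_dom i p ->
    {for p, continuous (coord i)} ;
  rm_param_cont : forall (i : chart M) x, chart_img i x ->
    {for x, continuous (param i)} ;
  rm_transition : forall i j : chart M,
    smooth_on (coord i @` (chart_dom i `&` chart_dom j)) (coord j \o param i) ;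
  rm_metric_smooth : forall i : chart M, smooth_on (chart_img i) (gmat i) ;
  rm_metric_sym : forall (i : chart M) x, chart_img i x ->
    (gmat i x)^T = gmat i x ;
  rm_metric_pos : forall (i : chart M) x, chart_img i x ->
    forall v : 'rV[R]_m, v != 0 -> 0 < (v *m gmat i x *m v^T) 0 0 ;
  rm_metric_tensor : forall (i j : chart M) p,
    chart_dom i p -> chart_dom j p ->
    let J := jacobian (coord j \o param i) (coord i p) in
    gmat i (coord i p) = J *m gmat j (coord j p) *m J^T }.

Definition coord_at m (M : riemData R m) (p : M) : 'rV[R]_m :=
  coord (chart_at p) p.

Definition metric_at m (M : riemData R m) (p : M) : 'M[R]_m :=
  gmat (chart_at p) (coord_at p).

Definition inner m (M : riemData R m) (p : M) (v w : 'rV[R]_m) : R :=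
  (v *m metric_at p *m w^T) 0 0.

Definition tnorm m (M : riemData R m) (p : M) (v : 'rV[R]_m) : R :=
  Num.sqrt (inner p v v).

(* Components (df(e_1), ..., df(e_m)) of df, and the gradient g^{ij} f_j.     *)
Definition dfun m (M : riemData R m) (f : M -> R) (p : M) : 'rV[R]_m :=
  \row_a 'D_(delta_mx 0 a) (f \o param (chart_at p)) (coord_at p).

Definition grad m (M : riemData R m) (f : M -> R) (p : M) : 'rV[R]_m :=
  dfun f p *m invmx (metric_at p).

(* Gamma^k_ij = 1/2 sum_l g^kl (d_i g_jl + d_j g_il - d_l g_ij).              *)
Definition christoffel m (G : 'rV[R]_m -> 'M[R]_m) (x : 'rV[R]_m)
    (k i j : 'I_m) : R :=
  let dG l a b := 'D_(delta_mx 0 l) (fun y => G y a b) x in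
  2^-1 * \sum_l invmx (G x) k l * (dG i j l + dG j i l - dG l i j).

Definition christoffel_form m (G : 'rV[R]_m -> 'M[R]_m) (x : 'rV[R]_m)
    (v w : 'rV[R]_m) : 'rV[R]_m :=
  \row_k \sum_i \sum_j christoffel G x k i j * v 0 i * w 0 j.

Definition smooth_curve m (M : riemData R m) (J : set R) (gamma : R -> M) :=
  (forall t, J t -> {for t, continuous gamma}) /\
  (forall i : chart M,
    smooth_on (J `&` gamma @^-1` chart_dom i) (coord i \o gamma)).

(* Smoothness on a compact interval is smoothness of an extension to an open  *)
(* neighbourhood.                                                             *)
Definition smooth_arc m (M : riemData R m) (a b : R) (gamma : R -> M) :=
  exists J : set R, [/\ open J, `[a, b] `<=` J & smooth_curve J gamma].

Definition velocity m (M : riemData R m) (gamma : R -> M) (t : R) : 'rV[R]_m :=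
  derive1 (coord (chart_at (gamma t)) \o gamma) t.

Definition speed m (M : riemData R m) (gamma : R -> M) (t : R) : R :=
  tnorm (gamma t) (velocity gamma t).

Definition arc_length m (M : riemData R m) (a b : R) (gamma : R -> M) : R :=
  \int[mu]_(t in `[a, b]) speed gamma t.

(* [path_length x y l]: some piecewise smooth curve from x to y, that is a    *)
(* finite concatenation of smooth arcs, has length l.                         *)
Inductive path_length m (M : riemData R m) : M -> M -> R -> Prop :=
| path_nil x : path_length x x 0
| path_cons a b (gamma : R -> M) y l :
    a <= b -> smooth_arc a b gamma -> path_length (gamma b) y l ->
    path_length (gamma a) y (arc_length a b gamma + l).

Definition dist m (M : riemData R m) (x y : M) : R :=
  inf [set l | path_length x y l].

Definition complete_riemannian m (M : riemData R m) : Prop :=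
  forall u : nat -> M,
    (forall e, 0 < e -> exists N : nat, forall i j : nat,
      (N <= i)%N -> (N <= j)%N -> dist (u i) (u j) < e) ->
    exists p : M, dist (u k) p @[k --> \oo] --> (0 : R).

(* Covariant acceleration of gamma: (gamma^k)'' + Gamma^k_ij gamma^i' gamma^j'. *)
Definition acceleration m (M : riemData R m) (gamma : R -> M) (t : R) :
    'rV[R]_m :=
  let i := chart_at (gamma t) in
  let c := coord i \o gamma in
  derive1n 2 c t + christoffel_form (gmat i) (c t) (derive1 c t) (derive1 c t).

(* The two pointwise equations are imposed on the open interval; they extend  *)
(* to its end points by continuity, and for r = 0 the curve is just a point.  *)
Definition minimizing_unit_geodesic m (M : riemData R m) (r : R)
    (gamma : R -> M) (x y : M) : Prop :=
  [/\ smooth_arc 0 r gamma,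
      forall t, 0 < t < r -> acceleration gamma t = 0,
      forall t, 0 < t < r -> speed gamma t = 1,
      gamma 0 = x /\ gamma r = y &
      arc_length 0 r gamma = dist x y].

Section Immersions.
Context {m n : nat} {M : riemData R m} {N : riemData R n} (psi : M -> N).

Definition local_expr (i : chart M) (j : chart N) : 'rV[R]_m -> 'rV[R]_n :=
  coord j \o psi \o param i.

Definition smooth_map : Prop :=
  continuous psi /\
  forall (i : chart M) (j : chart N),
    smooth_on (coord i @` (chart_dom i `&` psi @^-1` chart_dom j))
              (local_expr i j).

Definition expr_at (p : M) : 'rV[R]_m -> 'rV[R]_n :=
  local_expr (chart_at p) (chart_at (psi p)).

Definition tangent_map (p : M) : 'M[R]_(m, n) :=
  jacobian (expr_at p) (coord_at p).

Definition isometric_immersion : Prop :=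
  [/\ smooth_map,
      forall p, row_free (tangent_map p) &
      forall p v w, inner (psi p) (v *m tangent_map p) (w *m tangent_map p)
                    = inner p v w].

(* Row spaces in T_psi(p)N: the image of T_pM, and the vectors u with         *)
(* <u, dpsi(v)> = 0 for all v.                                                *)
Definition tangent_space (p : M) : 'M[R]_n := (<<tangent_map p>>)%MS.

Definition normal_space (p : M) : 'M[R]_n :=
  kermx (metric_at (psi p) *m (tangent_map p)^T).

Definition normal_part (p : M) (u : 'rV[R]_n) : 'rV[R]_n :=
  u *m proj_mx (normal_space p) (tangent_space p).

(* II(v, w) = (nabla_v dpsi(w))^perp with nabla the Levi-Civita connection of *)
(* N, the vector w being extended with constant components in [chart_at p].   *)
Definition second_fundamental_form (p : M) (v w : 'rV[R]_m) : 'rV[R]_n :=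
  let F := expr_at p in
  let x := coord_at p in
  normal_part p
    ('D_v ('D_w F) x +
     christoffel_form (gmat (chart_at (psi p))) (F x) ('D_v F x) ('D_w F x)).

Definition mean_curvature (p : M) : 'rV[R]_n :=
  \sum_a \sum_b invmx (metric_at p) a b *:
    second_fundamental_form p (delta_mx 0 a) (delta_mx 0 b).

Definition mcf_soliton (X : N -> 'rV[R]_n) : Prop :=
  isometric_immersion /\
  exists c : R, forall p, c *: normal_part p (X (psi p)) = mean_curvature p.

End Immersions.

Section WarpedProduct.
Context {n : nat} (I : set R) (t0 : I) (h : R -> R) (P : riemData R n).

(* The first coordinate on I x P is t; t0 is only used as the value of        *)
(* [param] outside of the image of the chart.                                 *)
Definition warped_product : riemData R (1 + n) :=
  @RiemData R (1 + n) (I * P)%type (chart P)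
    (fun q => chart_at q.2)
    (fun j => [set q | chart_dom j q.2])
    (fun j q => row_mx (\val q.1)%:M (coord j q.2))
    (fun j y => (insubd t0 (lsubmx y 0 0), param j (rsubmx y)))
    (fun j y => block_mx 1%:M 0 0 (h (lsubmx y 0 0) ^+ 2 *: gmat j (rsubmx y))).

Definition height (q : warped_product) : R := \val q.1.

Definition h_dt (q : warped_product) : 'rV[R]_(1 + n) :=
  row_mx (h (height q))%:M 0.

End WarpedProduct.

(* The oriented integral of f from a to b.                                    *)
Definition oint (f : R -> R) (a b : R) : R :=
  if a <= b then \int[mu]_(s in `[a, b]) f s
  else - \int[mu]_(s in `[b, a]) f s.

End Riemannian.

(* Main.v *)
(* Write u = pi o psi. Since etahat' = h > 0, the gradient of eta is the      *)
(* tangential part of h d/dt, whence |grad eta| <= h(u). The height u is      *)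
(* 1-Lipschitz on M, so along a curve gamma the function h(u(gamma)) has      *)
(* derivative at most |h'(u(gamma))| |gamma'|, and integrating gives the first*)
(* bound. For the second one the same estimate, applied to arbitrary piecewise*)
(* smooth curves instead of geodesics, makes h(u) Lipschitz for [dist]; as M  *)
(* is connected, such curves exist, and no minimizing geodesic is needed.     *)
Require Import Defs.

Set Implicit Arguments.
Unset Strict Implicit.
Unset Printing Implicit Defensive.

Local Open Scope classical_set_scope.
Local Open Scope ring_scope.

(** The warped metric dominates dt^2 ([warped_inner_ge]) and psi is isometric, so the differential
    of the height u is bounded by the norm of the tangent vector ([height_tangent_le]). This is used
    twice. Pairing the gradient with itself yields |grad eta| <= |etahat'(u)|
    ([tnorm_grad_height_le]), and etahat' = h by the fundamental theorem of calculus
    ([derive1_oint]). Along a curve it yields |(u o gamma)'| <= |gamma'| ([height_curve]), so the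
    growth of h(u) is controlled by the integral of |h'(u)| |gamma'| ([warp_increment_le]). Both
    estimates hold with C = h(u(o)). Along a unit speed geodesic from o the integrand is |h'(u)|. If
    |h'| <= B on I, every piecewise smooth path of length l from o to x gives h(u(x)) - h(u(o)) <= B
    l. The infimum over paths turns l into the distance, once connectedness makes the set of lengths
    nonempty ([connected_path_length]). *)

Section Calculus.

(** * One-variable calculus: increments and oriented integrals *)

Context {R : realType}.
Notation mu := (@lebesgue_measure R).

Lemma continuous_itv_integrable (g : R -> R) (a b : R) :
  (forall t, a <= t <= b -> {for t, continuous g}) ->
  mu.-integrable `[a, b] (EFin \o g).
Proof.
move=> cg; apply: continuous_compact_integrable; first exact: segment_compact.
by apply: continuous_in_subspaceT => t; rewrite inE/= in_itv/=; exact: cg.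
Qed.

(** With G the primitive of g from a, F - G has nonpositive derivative and is therefore
    nonincreasing. The fundamental theorem is applied to the continuous g alone, so F' needs only
    the bound by g, not integrability. *)
Lemma increment_le_Rintegral (F g : R -> R) (a b : R) : a <= b ->
  (forall t, a <= t <= b -> {for t, continuous F}) ->
  (forall t, a <= t <= b -> {for t, continuous g}) ->
  (forall t, a < t < b -> derivable F t 1) ->
  (forall t, a < t < b -> derive1 F t <= g t) ->
  F b - F a <= \int[mu]_(t in `[a, b]) g t.
Proof.
rewrite le_eqVlt => /predU1P[<- *|ab cF cg dF Fg].
  by rewrite subrr set_itv1 Rintegral_set1.
have ig := continuous_itv_integrable cg.
pose G (x : R) : R := \int[mu]_(t in `[a, x]) g t.
have dG t : a < t < b -> derivable G t 1 /\ derive1 G t = g t.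
  move=> /andP[at_ tb]; apply: (continuous_FTC1_closed tb) => //.
  by apply: cg; rewrite !ltW.
have dFG t : a < t < b -> derivable (F - G) t 1.
  by move=> tab; apply: derivableB; [exact: dF|exact: (dG t tab).1].
have : (F - G) b <= (F - G) a.
  apply: (@ler0_derive1_le_cc _ (F - G) a b); rewrite ?in_itv/= ?lexx ?ltW//.
  - move=> t; rewrite in_itv/= => tab; rewrite derive1E deriveB; last 2 first.
    + exact: dF.
    + exact: (dG t tab).1.
    by rewrite -!derive1E subr_le0 (dG t tab).2 Fg.
  - move=> t; apply: cvgB; last first.
      exact: (parameterized_integral_continuous (ltW ab) ig).
    apply: (@continuous_in_subspaceT _ _ `[a, b]) => s.
    by rewrite inE/= in_itv/=; exact: cF.
rewrite !fctE /G set_itv1 Rintegral_set1 subr0.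
by rewrite lerBlDl addrC -lerBlDl.
Qed.

(** The point t may lie on either side of t0. Openness of I leaves room for some a below both and b
    above both; on that interval the oriented integral is G - G(t0), with G the primitive from a,
    whatever the orientation. *)
Lemma derive1_oint (I : set R) (f : R -> R) (t0 t : R) :
  open I -> is_interval I -> I t0 -> I t ->
  (forall s, I s -> {for s, continuous f}) -> derive1 (oint f t0) t = f t.
Proof.
move=> Iop Iitv It0 It cf.
have ball_in s : I s -> exists2 e, 0 < e & I (s - e) /\ I (s + e).
  move=> Is; have /nbhs_ballP[e /= e0 eI] : nbhs s I by exact: open_nbhs_nbhs.
  have e2 : `|e / 2| < e.
    by rewrite gtr0_norm ?divr_gt0// ltr_pdivrMr// ltr_pMr// ltr1n.
  exists (e / 2); first by rewrite divr_gt0.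
  split; apply: eI; rewrite /ball/=; first by rewrite subKr.
  by rewrite opprD addrA subrr sub0r normrN.
have left_pt s : I s -> exists2 x, x < s & I x.
  by move=> /ball_in[e e0 [Ie _]]; exists (s - e) => //; rewrite ltrBlDr ltrDl.
have right_pt s : I s -> exists2 x, s < x & I x.
  by move=> /ball_in[e e0 [_ Ie]]; exists (s + e) => //; rewrite ltrDl.
have [a [Ia at0 at_]] : exists a, [/\ I a, a < t0 & a < t].
  have [a amin Ia] : exists2 a, a < Num.min t0 t & I a.
    by apply: left_pt; rewrite /Num.min; case: ifP.
  by exists a; move: amin; rewrite lt_min => /andP[].
have [b [Ib t0b tb]] : exists b, [/\ I b, t0 < b & t < b].
  have [b bmax Ib] : exists2 b, Num.max t0 t < b & I b.
    by apply: right_pt; rewrite /Num.max; case: ifP.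
  by exists b; move: bmax; rewrite gt_max => /andP[].
have cfab s : a <= s <= b -> {for s, continuous f}.
  by move=> sab; apply: cf; exact: Iitv sab.
have iab := continuous_itv_integrable cfab.
pose G (x : R) : R := \int[mu]_(s in `[a, x]) f s.
have [dG G'] : derivable G t 1 /\ derive1 G t = f t.
  apply: (continuous_FTC1_closed tb) => //; exact: cf.
rewrite -G' !derive1E -[RHS]subr0 -(derive_cst (G t0) t 1) -deriveB//.
apply: near_eq_derive; near=> s.
have as_ : a < s by near: s; exact: lt_nbhsr.
have sb : s < b by near: s; exact: lt_nbhsl.
have GB x y : a < x -> x <= y -> y < b ->
    G y - G x = \int[mu]_(s in `[x, y]) f s.
  move=> ax xy yb; rewrite /G Rintegral_itvB ?bnd_simp ?(ltW ax)//.
    apply: Rintegral_itv_obnd_cbnd; apply: (integrableS _ _ _ iab) => //.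
    by apply: subset_itv; rewrite bnd_simp ltW.
  apply: (integrableS _ _ _ iab) => //.
  by apply: subset_itv; rewrite bnd_simp ?lexx ?ltW.
rewrite /oint !fctE /=; case: leP => [t0s|/ltW st0]; first by rewrite GB.
by rewrite -GB// opprB.
Unshelve. all: by end_near. Qed.

End Calculus.

(** * Restriction of C^k maps to subsets and to lines *)

Section Smooth.
Context {R : realType} {V W : normedModType R}.
Implicit Types (U : set V) (f : V -> W).

Lemma Ck_on_subset k U1 U2 f : U1 `<=` U2 -> Ck_on k U2 f -> Ck_on k U1 f.
Proof.
move=> U12; elim: k f => [|k IHk] f /=; first by move=> cf x /U12; exact: cf.
by move=> [df Df]; split => [x /U12|v]; [exact: df|exact: IHk].
Qed.

Lemma differentiable_line (x w : V) (t : R) :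
  differentiable (fun s : R => x + s *: w) t.
Proof. by apply: differentiableD => //; exact: differentiableZl. Qed.

(** Differentiating along the line in the real direction v amounts to taking the derivative of f in
    the direction [v *: w] at the same point. The result is again a map restricted to the line, so
    induction on k applies. *)
Lemma Ck_on_line k U f (x w : V) : Ck_on k U f ->
  Ck_on k ((fun t : R => x + t *: w) @^-1` U) (fun t : R => f (x + t *: w)).
Proof.
elim: k f => [|k IHk] f /=.
  move=> cf t Ut.
  apply: (@continuous_comp _ _ _ (fun t : R => x + t *: w) f); last exact: cf.
  exact: (@differentiable_continuous _ _ _ t _ (differentiable_line x w t)).
move=> [df Df]; split => [t Ut|v].
  exact: (differentiable_comp (differentiable_line x w t) (df _ Ut)).
suff -> : 'D_v (fun t : R => f (x + t *: w)) =
          (fun t => 'D_(v *: w) f (x + t *: w)).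
  exact: IHk ('D_(v *: w) f) (Df _).
apply/funext => t; rewrite /derive; apply: (congr1 (fun F => lim (F @ 0^'))).
apply/funext => s /=; congr (_ *: (f _ - _)).
by rewrite scalerDl scalerA addrCA.
Qed.

End Smooth.

(** * Existence of piecewise smooth paths *)

Section RiemannianCurves.
Context {R : realType} {m : nat} (M : riemData R m) (M_riem : is_riemannian M).

(** Read in any other chart, a coordinate segment is a transition map restricted to a line. *)
Lemma smooth_arc_chart_line (i : chart M) (x y : 'rV[R]_m) :
  (forall t, 0 <= t <= 1 -> chart_img i (x + t *: (y - x))) ->
  smooth_arc 0 1 (fun t : R => param i (x + t *: (y - x))).
Proof.
move=> xy; pose l (t : R) := x + t *: (y - x).
have cl t : {for t, continuous l}.
  exact: differentiable_continuous (differentiable_line _ _ _).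
exists (l @^-1` chart_img i); split.
- apply: open_comp; last exact: rm_img_open M_riem i.
  by move=> t _; exact: cl.
- by move=> t; rewrite /= in_itv/=; exact: xy.
split=> [t lt|j].
  apply: (@continuous_comp _ _ _ l (param i)); first exact: cl.
  exact: rm_param_cont M_riem i _ lt.
move=> k; pose U := coord i @` (chart_dom i `&` chart_dom j).
apply: (@Ck_on_subset _ _ _ _ _ (l @^-1` U)); last first.
  exact: (Ck_on_line (f := coord j \o param i) _ _ (rm_transition M_riem i j k)).
move=> t [[p ip pl] /= jp]; exists p => //; split=> //.
by rewrite -(rm_coordK M_riem ip) pl.
Qed.

Lemma path_length_trans (x y z : M) (l l' : R) :
  path_length x y l -> path_length y z l' -> path_length x z (l + l').
Proof.
move=> xy; elim: xy l' => {x y l} [x l' xz|a b gamma y l ab sgamma _ IH l' yz].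
  by rewrite add0r.
by rewrite -addrA; apply: path_cons => //; exact: IH.
Qed.

(** Balls in coordinates are convex, so coordinate segments join the points of a small chart
    neighbourhood. *)
Lemma locally_path_connected (p : M) :
  exists2 U : set M, open_nbhs p U &
    forall x y, U x -> U y -> exists l, path_length x y l.
Proof.
pose i := chart_at p.
have ip : chart_dom i p by exact: rm_chart_at M_riem p.
have : nbhs (coord i p) (chart_img i).
  by apply: open_nbhs_nbhs; split; [exact: rm_img_open M_riem i|exists p].
move=> /nbhs_ballP[e /= e0 eI].
pose V := chart_dom i `&` coord i @^-1` ball (coord i p) e.
have Vp : nbhs p V.
  apply: filterI; first by apply: open_nbhs_nbhs; split => //; exact: rm_dom_open.
  by apply: (rm_coord_cont M_riem ip); exact: nbhsx_ballx.
exists V^°; first by split; [exact: open_interior|].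
move=> x y /interior_subset[ix xe] /interior_subset[iy ye].
pose gamma (t : R) := param i (coord i x + t *: (coord i y - coord i x)).
have g0 : gamma 0 = x by rewrite /gamma scale0r addr0 (rm_coordK M_riem ix).
have g1 : gamma 1 = y by rewrite /gamma scale1r subrKC (rm_coordK M_riem iy).
exists (arc_length 0 1 gamma + 0).
rewrite -{1}g0; apply: path_cons => //; last by rewrite g1; exact: path_nil.
apply: smooth_arc_chart_line => t /andP[t0 t1]; apply: eI.
have -> : coord i x + t *: (coord i y - coord i x) =
          (1 - t) *: coord i x + t *: coord i y.
  by rewrite scalerBr scalerBl scale1r addrCA addrC.
move: xe ye; rewrite /= -!ball_normE /ball_/= => xe ye.
have -> : coord i p - ((1 - t) *: coord i x + t *: coord i y) =
  (1 - t) *: (coord i p - coord i x) + t *: (coord i p - coord i y).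
  by rewrite !scalerBr addrACA -opprD -scalerDl subrK scale1r.
have t1' : 0 <= 1 - t by rewrite subr_ge0.
apply: (le_lt_trans (ler_normD _ _)); rewrite !normrZ (ger0_norm t0) (ger0_norm t1').
(* For t > 0 the strict inequality is carried by the summand with factor t; at t = 0 that summand
   vanishes. *)
have [->|tn0] := eqVneq t 0; first by rewrite subr0 mul1r mul0r addr0.
have -> : e = (1 - t) * e + t * e by rewrite -mulrDl subrK mul1r.
by apply: ler_ltD; [rewrite ler_wpM2l// ltW|rewrite ltr_pM2l// lt_def tn0].
Qed.

(** The set of points reachable from x is nonempty, open and closed; the last two follow by
    concatenating with short paths in a neighbourhood. *)
Lemma connected_path_length (x y : M) : connected [set: M] ->
  exists l, path_length x y l.
Proof.
move=> connM; pose S := [set z : M | exists l, path_length x z l].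
suff : S = [set: M] by move=> ST; have : S y by rewrite ST.
apply: connM; first by exists x; exists 0; exact: path_nil.
- exists S; last by rewrite setTI.
  rewrite openE => z [l xz]; have [U Uz Upath] := locally_path_connected z.
  apply: filterS (open_nbhs_nbhs Uz) => w Uw.
  have [l' zw] := Upath _ _ (nbhs_singleton (open_nbhs_nbhs Uz)) Uw.
  by exists (l + l'); exact: path_length_trans xz zw.
- exists S; last by rewrite setTI.
  move=> z clz; have [U Uz Upath] := locally_path_connected z.
  have [w [[l xw] Uw]] := clz U (open_nbhs_nbhs Uz).
  have [l' wz] := Upath _ _ Uw (nbhs_singleton (open_nbhs_nbhs Uz)).
  by exists (l + l'); exact: path_length_trans xw wz.
Qed.

Lemma arc_length_ge0 a b (gamma : R -> M) : 0 <= arc_length a b gamma.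
Proof. by apply: Rintegral_ge0 => t _; exact: sqrtr_ge0. Qed.

End RiemannianCurves.

(** * Jacobians and limits of matrix expressions *)

Section MatrixCalculus.
Context {R : realType}.

Lemma derive1_comp_jacobian m n (c : R -> 'rV[R]_m) (f : 'rV[R]_m -> 'rV[R]_n)
    (t : R) :
  differentiable c t -> differentiable f (c t) ->
  derive1 (f \o c) t = derive1 c t *m jacobian f (c t).
Proof.
move=> dc df; rewrite !derive1E' //; last exact: differentiable_comp.
by rewrite diff_comp //= /jacobian mul_rV_lin1.
Qed.

Lemma near_eq_derive1 (V : normedModType R) (f g : R -> V) (t : R) :
  (\near t, f t = g t) -> derive1 f t = derive1 g t.
Proof. by move=> fg; rewrite !derive1E; exact: near_eq_derive. Qed.

Lemma cvg_mx_entry (T : Type) (F : set_system T) m n (A : T -> 'M[R]_(m, n))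
   (l : 'M[R]_(m, n)) i j : A x @[x --> F] --> l -> A x i j @[x --> F] --> l i j.
Proof.
move=> Al; apply: (cvg_comp _ (fun B : 'M[R]_(m, n) => B i j) Al).
exact: coord_continuous.
Qed.

Lemma cvg_quadratic (T : Type) (F : set_system T) (FF : Filter F) n
    (v : T -> 'rV[R]_n) (G : T -> 'M[R]_n) (v0 : 'rV[R]_n) (G0 : 'M[R]_n) :
  v x @[x --> F] --> v0 -> G x @[x --> F] --> G0 ->
  (v x *m G x *m (v x)^T) 0 0 @[x --> F] --> (v0 *m G0 *m v0^T) 0 0.
Proof.
move=> vl Gl.
have E (w : 'rV[R]_n) (H : 'M[R]_n) : (w *m H *m w^T) 0 0 =
    \sum_j (\sum_i w 0 i * H i j) * w 0 j.
  by rewrite mxE; apply: eq_bigr => j _; rewrite !mxE.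
rewrite E; under eq_cvg do rewrite E.
apply: cvg_big => [|j _]; first exact: add_continuous.
apply: cvgM; last exact: cvg_mx_entry.
apply: cvg_big => [|i _]; first exact: add_continuous.
by apply: cvgM; exact: cvg_mx_entry.
Qed.

End MatrixCalculus.

(** * Speed of a smooth curve and its continuity *)

Section Speed.
Context {R : realType} {m : nat} (M : riemData R m) (M_riem : is_riemannian M).
Context (J : set R) (gamma : R -> M) (Jop : open J) (sgamma : smooth_curve J gamma).
Notation mu := (@lebesgue_measure R).

Lemma near_smooth_curve_dom (i : chart M) (t : R) : J t -> chart_dom i (gamma t) ->
  \forall s \near t, J s /\ chart_dom i (gamma s).
Proof.
move=> Jt it; apply: filterI; first exact: open_nbhs_nbhs.
apply: (sgamma.1 _ Jt); apply: open_nbhs_nbhs; split => //; exact: rm_dom_open.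
Qed.

Lemma smooth_curve_coord_differentiable (i : chart M) (t : R) :
  J t -> chart_dom i (gamma t) -> differentiable (coord i \o gamma) t.
Proof. by move=> Jt it; apply: (sgamma.2 i 1%N).1. Qed.

(** [speed] uses the chart [chart_at (gamma t)], which may jump with t. The tensor law of the metric
    and the chain rule for the transition map replace it by a fixed chart, where continuity of the
    speed can be read off. *)
Lemma speed_in_chart (i : chart M) (t : R) : J t -> chart_dom i (gamma t) ->
  let v := derive1 (coord i \o gamma) t in
  speed gamma t = Num.sqrt ((v *m gmat i (coord i (gamma t)) *m v^T) 0 0).
Proof.
move=> Jt it v; rewrite /speed /tnorm /inner /metric_at /coord_at /velocity.
set k := chart_at (gamma t); set w := derive1 (coord k \o gamma) t.
have kt : chart_dom k (gamma t) by exact: rm_chart_at M_riem _.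
rewrite (rm_metric_tensor M_riem it kt).
suff -> : w = v *m jacobian (coord k \o param i) (coord i (gamma t)).
  by rewrite trmx_mul !mulmxA.
rewrite -derive1_comp_jacobian.
- apply: near_eq_derive1; near=> s => /=.
  by rewrite (rm_coordK M_riem)//; near: s;
    apply: filterS (near_smooth_curve_dom Jt it) => s [].
- exact: smooth_curve_coord_differentiable.
- by apply: (rm_transition M_riem i k 1%N).1; exists (gamma t).
Unshelve. all: by end_near. Qed.

Lemma speed_continuous (t : R) : J t -> {for t, continuous (speed gamma)}.
Proof.
move=> Jt; set i := chart_at (gamma t).
have it : chart_dom i (gamma t) by exact: rm_chart_at M_riem _.
pose c := coord i \o gamma.
pose q s := (derive1 c s *m gmat i (c s) *m (derive1 c s)^T) 0 0.
have speedE : \forall s \near t, Num.sqrt (q s) = speed gamma s.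
  apply: filterS (near_smooth_curve_dom Jt it) => s [Js is_].
  by rewrite (speed_in_chart Js is_).
rewrite /prop_for /continuous_at -(nbhs_singleton speedE).
apply: cvg_trans; first exact: near_eq_cvg speedE.
apply: (@cvg_comp _ _ _ q Num.sqrt _ (nbhs (q t))); last exact: sqrt_continuous.
have cc : {for t, continuous c}.
  by apply: differentiable_continuous; exact: smooth_curve_coord_differentiable.
apply: cvg_quadratic.
- have -> : derive1 c = 'D_1 c by apply/funext => s; rewrite derive1E.
  exact: ((sgamma.2 i 1%N).2 1).
- apply: (cvg_comp c (gmat i) cc).
  by apply: (rm_metric_smooth M_riem i 0%N); exists (gamma t).
Qed.

Lemma arc_length_scale a b (k : R) : `[a, b] `<=` J ->
  \int[mu]_(t in `[a, b]) (k * speed gamma t) = k * arc_length a b gamma.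
Proof.
move=> abJ; apply: RintegralZl => //; apply: continuous_itv_integrable => t tab.
by apply: speed_continuous; apply: abJ; rewrite /= in_itv.
Qed.

End Speed.

(** * Chain rule for real functions and derivatives of the t-component *)

Section ChainRule.
Context {R : realType} {V : normedModType R}.

Lemma derive_compR (u : V -> R) (f : R -> R) (x v : V) :
  differentiable u x -> differentiable f (u x) ->
  'D_v (f \o u) x = derive1 f (u x) * 'D_v u x.
Proof.
move=> du df; rewrite (deriveE _ du) (derive1E' df).
rewrite deriveE; last exact: differentiable_comp.
rewrite diff_comp//= mulrC -[LHS]/('d f (u x) ('d u x v)).
by rewrite -[in LHS](mulr1 ('d u x v)) [LHS]linearZ.
Qed.

Lemma lsubmx_derive n (F : V -> 'rV[R]_(1 + n)) (x v : V) :
  differentiable F x ->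
  'D_v (fun y => lsubmx (F y) 0 0) x = lsubmx ('D_v F x) 0 0.
Proof.
move=> dF; rewrite derive_mx; last exact: diff_derivable.
by rewrite !mxE; congr ('D_v _ x); apply/funext => y; rewrite mxE.
Qed.

Lemma differentiable_lsubmx00 n (F : V -> 'rV[R]_(1 + n)) (x : V) :
  differentiable F x -> differentiable (fun y => lsubmx (F y) 0 0) x.
Proof.
move=> dF; apply: (@differentiable_comp _ _ _ _
  (fun y => lsubmx (F y)) (fun A : 'M[R]_1 => A 0 0)).
  by apply: differentiable_comp => //; exact: differentiable_lsubmx.
exact: differentiable_coord.
Qed.

End ChainRule.

(** * The height function of an isometric immersion into the warped product *)

Section WarpedProduct.
Context {R : realType} {m n : nat} (I : set R) (t0 : I) (h : R -> R).
Context (P : riemData R n) (P_riem : is_riemannian P).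
Context (M : riemData R m) (M_riem : is_riemannian M).
Notation N := (warped_product t0 h P).

Lemma height_I (q : N) : I (height q).
Proof. exact: set_valP. Qed.

(** The metric is block diagonal, and the fibre block contributes h^2 times a nonnegative quadratic
    form. *)
Lemma warped_inner_ge (q : N) (w : 'rV[R]_(1 + n)) :
  lsubmx w 0 0 ^+ 2 <= inner q w w.
Proof.
rewrite /inner /metric_at /coord_at /= row_mxKl row_mxKr -{2 3}[w]hsubmxK.
rewrite tr_row_mx mul_row_block !mulmx0 addr0 add0r mulmx1 mul_row_col [leRHS]mxE.
have -> : (lsubmx w *m (lsubmx w)^T) 0 0 = lsubmx w 0 0 ^+ 2.
  by rewrite mxE big_ord1 [X in _ * X]mxE expr2.
rewrite lerDl -scalemxAr -scalemxAl mxE mulr_ge0 ?sqr_ge0//.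
(* Positivity of the fibre metric is available for nonzero vectors only. *)
have [->|w0] := eqVneq (rsubmx w) 0; first by rewrite !mul0mx mxE.
apply/ltW/(rm_metric_pos P_riem) => //.
by exists q.2 => //; exact: rm_chart_at.
Qed.

Context (psi : M -> N) (psi_iso : isometric_immersion psi).

(** The left side is |du(v)|, with u the height along psi; since psi is isometric, the norm of v is
    that of dpsi(v), which dominates its dt-component. *)
Lemma height_tangent_le (p : M) (v : 'rV[R]_m) :
  `|lsubmx (v *m tangent_map psi p) 0 0| <= tnorm p v.
Proof.
have [_ _ iso] := psi_iso.
by rewrite /tnorm -iso -sqrtr_sqr ler_wsqrtr// warped_inner_ge.
Qed.

Lemma expr_at_differentiable (p : M) : differentiable (expr_at psi p) (coord_at p).
Proof.
have [[_ spsi] _ _] := psi_iso.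
apply: (spsi (chart_at p) (chart_at (psi p)) 1%N).1; exists p => //; split.
  exact: rm_chart_at M_riem p.
exact: rm_chart_at P_riem (psi p).2.
Qed.

Lemma height_expr_at (p : M) (x : 'rV[R]_m) :
  height (psi (param (chart_at p) x)) = lsubmx (expr_at psi p x) 0 0.
Proof. by rewrite /expr_at /local_expr /= row_mxKl mxE eqxx mulr1n. Qed.

(** A vector in the kernel would have zero norm, against positive definiteness. *)
Lemma metric_unit (p : M) : metric_at p \in unitmx.
Proof.
rewrite -row_free_unit -kermx_eq0; apply/rowV0P => v /sub_kermxP vg0.
apply/eqP; apply: contraT => v0.
have := rm_metric_pos M_riem (i := chart_at p) (x := coord_at p) _ v0.
rewrite -/(metric_at p) vg0 mul0mx mxE ltxx; apply.
by exists p => //; exact: rm_chart_at M_riem p.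
Qed.

Lemma dfun_height (f : R -> R) (p : M) : differentiable f (height (psi p)) ->
  dfun (fun x => f (height (psi x))) p =
  derive1 f (height (psi p)) *: (lsubmx (tangent_map psi p))^T.
Proof.
move=> df; have dF := expr_at_differentiable p.
have hp : lsubmx (expr_at psi p (coord_at p)) 0 0 = height (psi p).
  by rewrite -height_expr_at (rm_coordK M_riem)//; exact: rm_chart_at M_riem p.
apply/rowP => a; rewrite !mxE.
have -> : (fun x => f (height (psi x))) \o param (chart_at p) =
          f \o (fun y => lsubmx (expr_at psi p y) 0 0).
  by apply/funext => y /=; rewrite -height_expr_at.
rewrite derive_compR ?hp//; last exact: differentiable_lsubmx00.
by rewrite lsubmx_derive// deriveEjacobian// -rowE !mxE.
Qed.

(* With w the gradient and u the height, |w|^2 = f'(u) du(w) <= |f'(u)| |w|.   *)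
Lemma tnorm_grad_height_le (f : R -> R) (p : M) :
  differentiable f (height (psi p)) ->
  tnorm p (grad (fun x => f (height (psi x))) p) <=
  `|derive1 f (height (psi p))|.
Proof.
move=> df; set w := grad _ p; set k := derive1 f _.
have wE : inner p w w = k * lsubmx (w *m tangent_map psi p) 0 0.
  rewrite /inner {1}/w /grad mulmxKV ?metric_unit// dfun_height// -/k.
  by rewrite -scalemxAl mxE -trmx_mul mxE mulmx_lsub.
have [->|s0] := eqVneq (tnorm p w) 0; first exact: normr_ge0.
have w0 : 0 <= inner p w w.
  by apply: contraNT s0; rewrite -ltNge /tnorm => /ltW/ler0_sqrtr ->.
have spos : 0 < tnorm p w by rewrite lt_def s0 sqrtr_ge0.
rewrite -(ler_pM2r spos) -expr2 sqr_sqrtr// wE.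
apply: (le_trans (ler_norm _)); rewrite normrM.
by apply: ler_wpM2l => //; exact: height_tangent_le.
Qed.

(** * Height and warping function along a curve *)

Section Curve.
Context (J : set R) (gamma : R -> M) (Jop : open J) (sgamma : smooth_curve J gamma).
Let u (t : R) := height (psi (gamma t)).

(** In the chart used by [velocity] at t, u is the first component of psi along the curve, so u' is
    the dt-component of dpsi(gamma'). *)
Lemma height_curve (t : R) : J t ->
  derivable u t 1 /\ `|derive1 u t| <= speed gamma t.
Proof.
move=> Jt; set i := chart_at (gamma t).
have it : chart_dom i (gamma t) by exact: rm_chart_at M_riem _.
pose c := coord i \o gamma; pose F := expr_at psi (gamma t).
have dc : differentiable c t by exact: (smooth_curve_coord_differentiable sgamma).
have dF : differentiable F (c t) by exact: expr_at_differentiable.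
have dFc : differentiable (F \o c) t by exact: differentiable_comp.
have uE : \forall s \near t, lsubmx ((F \o c) s) 0 0 = u s.
  apply: filterS (near_smooth_curve_dom M_riem Jop sgamma Jt it) => s [_ is_].
  by rewrite /= /F -height_expr_at (rm_coordK M_riem).
split.
  apply: (near_eq_derivable uE); apply: diff_derivable.
  exact: differentiable_lsubmx00.
rewrite -(near_eq_derive1 uE) derive1E lsubmx_derive// -derive1E.
rewrite derive1_comp_jacobian//; exact: height_tangent_le.
Qed.

Context (h_smooth : smooth_on I h).

Lemma height_curve_continuous (t : R) : J t -> {for t, continuous u}.
Proof.
by move=> /height_curve[/derivable1_diffP du _]; exact: differentiable_continuous.
Qed.

Lemma derive1_warp_curve_continuous (t : R) : J t ->
  {for t, continuous (fun s => `|derive1 h (u s)|)}.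
Proof.
move=> Jt.
apply: (@cvg_comp _ _ _ (fun s => derive1 h (u s)) (fun y => `|y|) _
  (nbhs (derive1 h (u t)))); last exact: norm_continuous.
apply: (@cvg_comp _ _ _ u (derive1 h) _ (nbhs (u t))).
  exact: height_curve_continuous.
have -> : derive1 h = 'D_1 h by apply/funext => s; rewrite derive1E.
by apply: ((h_smooth 1%N).2 1); exact: height_I.
Qed.

(** The bound g is left free to serve both estimates: g = |h'(u)| on a unit speed geodesic, g = B
    |gamma'| on an arbitrary arc. It is compared on the open interval only, which is where a
    geodesic is known to have unit speed. *)
Lemma warp_increment_le (a b : R) (g : R -> R) : a <= b -> `[a, b] `<=` J ->
  (forall t, a <= t <= b -> {for t, continuous g}) ->
  (forall t, a < t < b -> `|derive1 h (u t)| * speed gamma t <= g t) ->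
  h (u b) - h (u a) <= \int[lebesgue_measure]_(t in `[a, b]) g t.
Proof.
move=> ab abJ cg hg.
have dh t : differentiable h (u t).
  by apply: (h_smooth 1%N).1; exact: height_I.
have du t : J t -> differentiable u t.
  by move=> Jt; apply/derivable1_diffP; exact: (height_curve Jt).1.
have dhu t : J t -> differentiable (h \o u) t.
  by move=> Jt; apply: differentiable_comp => //; exact: du.
have Jin t : a <= t <= b -> J t by move=> tab; apply: abJ; rewrite /= in_itv.
have Jino t : a < t < b -> J t by move=> /andP[? ?]; apply: Jin; rewrite !ltW.
apply: (increment_le_Rintegral (F := h \o u)) => // t tab.
- by apply: differentiable_continuous; exact: dhu (Jin _ tab).
- by apply/derivable1_diffP; exact: dhu (Jino _ tab).
- have Jt := Jino _ tab.
  rewrite derive1_comp; [|exact/derivable1_diffP/du|exact/derivable1_diffP].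
  apply: le_trans (hg _ tab); apply: (le_trans (ler_norm _)); rewrite normrM.
  by apply: ler_wpM2l => //; exact: (height_curve Jt).2.
Qed.

End Curve.
End WarpedProduct.

(** * The two gradient estimates *)

Theorem proposition6p5 (R : realType) (m n : nat)
    (I : set R) (I_open : open I) (I_interval : is_interval I) (t0 : I)
    (h : R -> R) (h_smooth : smooth_on I h) (h_pos : forall t, I t -> 0 < h t)
    (P : riemData R n) (P_riem : is_riemannian P)
    (M : riemData R m) (M_riem : is_riemannian M)
    (M_complete : complete_riemannian M) (M_connected : connected [set: M])
    (psi : M -> warped_product t0 h P)
    (psi_soliton : mcf_soliton psi (@h_dt R n I t0 h P))
    (o : M)
    (etahat := oint h (\val t0))
    (chi : R -> R) (chi_C1 : Ck_on 1 [set: R] chi)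
    (chi_ge0 : forall s, (etahat @` I) s -> 0 <= chi s)
    (etahat_ode : forall t : R, I t ->
      is_derive t (1 : R) etahat (Num.sqrt (chi (etahat t)))) :
  let pi := @height R n I t0 h P in
  let eta := fun x : M => etahat (pi (psi x)) in
  let r := fun x : M => dist o x in
  (exists C : R, 0 <= C /\
    forall (x : M) (gamma : R -> M),
      minimizing_unit_geodesic (r x) gamma o x ->
      tnorm x (grad eta x) <=
        \int[lebesgue_measure]_(tau in `[0, r x])
          `| derive1 h (pi (psi (gamma tau))) | + C) /\
  ([bounded derive1 h t | t in I] ->
   exists B C : R, [/\ 0 <= B, 0 <= C &
     forall x : M, tnorm x (grad eta x) <= B * r x + C]).
Proof.
move=> pi eta r; have [psi_iso _] := psi_soliton.
have Ipi x : I (pi (psi x)) by exact: height_I.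
have grad_le x : tnorm x (grad eta x) <= h (pi (psi x)).
  (* The differential equation supplies differentiability of [etahat]; the value h of its derivative
     comes from [derive1_oint]. *)
  have ode := etahat_ode _ (Ipi x).
  have detahat : differentiable etahat (pi (psi x)).
    by apply/derivable1_diffP; exact: ex_derive.
  apply: (le_trans (tnorm_grad_height_le P_riem M_riem psi_iso detahat)).
  rewrite (derive1_oint I_open)//; first by rewrite gtr0_norm// h_pos.
  - exact: set_valP.
  - exact: (h_smooth 0%N).
split.
  exists (h (pi (psi o))); split=> [|x gamma]; first exact/ltW/h_pos.
  move=> [[J [Jop abJ sgamma]] _ gamma1 [g0 gr] len].
  apply: (le_trans (grad_le x)); rewrite -lerBlDr.
  (* The distance is nonnegative because the minimizing geodesic realizes it as a length. *)
  have r0 : 0 <= r x by have := arc_length_ge0 0 (r x) gamma; rewrite len.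
  have cg t : 0 <= t <= r x ->
      {for t, continuous (fun s => `|derive1 h (pi (psi (gamma s)))|)}.
    move=> trx.
    apply: (derive1_warp_curve_continuous P_riem M_riem psi_iso Jop sgamma) => //.
    by apply: abJ; rewrite /= in_itv.
  have := warp_increment_le P_riem M_riem psi_iso Jop sgamma h_smooth r0 abJ cg.
  by rewrite g0 gr; apply => t trx; rewrite gamma1// mulr1.
(* The bound is taken strictly positive so that the estimate can be divided by B; then (h(u(x)) -
   h(u(o))) / B only has to be a lower bound of the path lengths. *)
move=> /pinfty_ex_gt0[B B0 hB].
exists B, (h (pi (psi o))); split; [exact: ltW|exact/ltW/h_pos|move=> x].
apply: (le_trans (grad_le x)); rewrite -lerBlDr mulrC -ler_pdivrMr//.
apply: lb_le_inf; first exact: connected_path_length.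
move=> l; rewrite /= ler_pdivrMr// mulrC.
(* Induction on the arcs of the path: the increment of h(u) splits at the end point of the first
   arc. *)
elim=> {x l} [y|a b gamma y l ab [J [Jop abJ sgamma]] _ IH].
  by rewrite subrr mulr0.
rewrite mulrDr -(subrKA (h (pi (psi (gamma b))))) addrC lerD//.
rewrite -(arc_length_scale M_riem Jop sgamma)//.
apply: (warp_increment_le P_riem M_riem psi_iso Jop sgamma h_smooth) => // t tab.
  have Jt : J t by apply: abJ; rewrite /= in_itv.
  by apply: continuousM; [exact: cst_continuous|exact: speed_continuous Jt].
by apply: ler_wpM2r; [exact: sqrtr_ge0|exact: hB].
Qed.
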